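(* Let $\{(X_{t,T})_{t\in\mathbb{Z}}\}_{T\in\mathbb{N}}$ be a triangular array of real-valued processes that is locally strictly stationary (of order two) and satisfies the following two conditions. (A) There exists $K<\infty$ such that for all $t_0\in\mathbb{Z}$, $T\in\mathbb{N}$ and $(\tau_1,\tau_2)\in(0,1)^2$, $$\sum_{s\in\mathbb{Z}} |\gamma_{t_0;T}(s,\tau_1,\tau_2)|\le K.$$ (C) For each $t\in\mathbb{Z}$ and $T\in\mathbb{N}$, the marginal distribution function $x\mapsto F_{t;T}(x)$ of $X_{t,T}$ is continuous. Then the time-varying copula spectral density $\mathfrak{f}^u(\omega,\tau_1,\tau_2)$ is uniquely defined, i.e. it does not depend on the choice of the approximating processes: if $\{X_u(t),\ t\in\mathbb{Z}\}_{u\in(0,1)}$ and $\{\tilde X_u(t),\ t\in\mathbb{Z}\}_{u\in(0,1)}$ are two families of strictly stationary processes, each of which (with some constant, possibly different for the two families) is a family of approximating processes for $\{X_{t,T}\}$ in the definition of local strict stationarity, and $\mathfrak{f}^u$, $\tilde{\mathfrak{f}}^u$ are the corresponding time-varying copula spectral densities, then $\mathfrak{f}^u(\omega,\tau_1,\tau_2)=\tilde{\mathfrak{f}}^u(\omega,\tau_1,\tau_2)$ for all $u\in(0,1)$, $\omega\in(-\pi,\pi]$ and $(\tau_1,\tau_2)\in(0,1)^2$.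
   Context: Local strict stationarity. A triangular array $\{(X_{t,T})_{t\in\mathbb{Z}}\}_{T\in\mathbb{N}}$ of real-valued processes is called locally strictly stationary (of order two) if there exist a constant $L>0$ and, for every $u\in(0,1)$, a strictly stationary process $\{X_u(t),\ t\in\mathbb{Z}\}$ (the approximating processes) such that, for every $T\in\mathbb{N}$, every $u\in(0,1)$ and every $1\le r,s\le T$, $$\|F_{r,s;T}(\cdot,\cdot)-G^u_{r-s}(\cdot,\cdot)\|_\infty\le L\big(\max(|r/T-u|,|s/T-u|)+1/T\big),$$ where $\|\cdot\|_\infty$ is the supremum norm, $F_{r,s;T}$ is the joint distribution function of $(X_{r,T},X_{s,T})$, and $G^u_k$ is the joint distribution function of $(X_u(0),X_u(-k))$. Time-varying copula spectral density. For $u\in(0,1)$, $h\in\mathbb{Z}$ and $\tau_1,\tau_2\in(0,1)$, let $q^u(\tau)$ denote the marginal quantile of order $\tau$ of $X_u(t)$ (generalized inverse of its marginal distribution function), and let $$\gamma^u_h(\tau_1,\tau_2):=\mathrm{Cov}\big(\mathbb{I}_{\{X_u(t)\le q^u(\tau_1)\}},\ \mathbb{I}_{\{X_u(t-h)\le q^u(\tau_2)\}}\big),$$ where $\mathbb{I}$ denotes an indicator; by stationarity this does not depend on $t$. When these are summable over $h$, the time-varying copula spectral density is $$\mathfrak{f}^u(\omega,\tau_1,\tau_2):=\frac{1}{2\pi}\sum_{h=-\infty}^{\infty}\gamma^u_h(\tau_1,\tau_2)e^{-ih\omega},\qquad \tau_1,\tau_2\in(0,1),\ \omega\in(-\pi,\pi].$$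 Covariances in condition (A). Let $F_{t;T}$ denote the marginal distribution function of $X_{t,T}$ and $F^{-1}_{t;T}$ its generalized inverse. For $t_0,s\in\mathbb{Z}$, $T\in\mathbb{N}$ and $\tau_1,\tau_2\in(0,1)$, $$\gamma_{t_0;T}(s,\tau_1,\tau_2):=\mathrm{Cov}\Big(\mathbb{I}_{\{X_{\lfloor t_0+s/2\rfloor,T}\le F^{-1}_{\lfloor t_0+s/2\rfloor;T}(\tau_1)\}},\ \mathbb{I}_{\{X_{\lfloor t_0-s/2\rfloor,T}\le F^{-1}_{\lfloor t_0-s/2\rfloor;T}(\tau_2)\}}\Big).$$ *)

(* Defs.v *)
Set Warnings "-notation-overridden,-ambiguous-paths,-notation-incompatible-prefix".
From HB Require Import structures.
From mathcomp Require Import all_boot all_order all_algebra.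
From mathcomp Require Import all_classical all_reals all_analysis.
From mathcomp Require Import complex.
Set Implicit Arguments.
Unset Strict Implicit.
Unset Printing Implicit Defensive.
Import Order.TTheory GRing.Theory Num.Theory numFieldNormedType.Exports.
Local Open Scope classical_set_scope.
Local Open Scope ring_scope.

(* A process carries its own probability space, so that the rows of a
   triangular array and the approximating processes (one for each u) need not
   be defined on a common space: only their laws are ever compared. *)
Record process (R : realType) := Process {
  process_display : measure_display;
  process_space : measurableType process_display;
  process_prob : probability process_space R;
  process_rv :> int -> {RV process_prob >-> R} }.

(* Two-sided series as the limit of its symmetric partial sums over
   -n <= h <= n; the order of summation is immaterial for absolutely summable
   terms. *)
Definition Zseries (C : numFieldType) (c : int -> C) : C :=
  limn (fun n : nat => \sum_(k < n.*2.+1) c (k%:Z - n%:Z)).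

Section Process.
Context {R : realType}.
Implicit Types (Y : process R) (r s t h : int) (x y a b tau omega : R).

Definition strictly_stationary Y : Prop :=
  forall (n : nat) (t : n.-tuple int) h (A : set (n.-tuple R)), measurable A ->
    pushforward (process_prob Y)
      (fun w => [tuple Y (tnth t i + h) w | i < n]) A =
    pushforward (process_prob Y) (fun w => [tuple Y (tnth t i) w | i < n]) A.

Definition marginal_df Y t x : R := fine (cdf (Y t) x).

Definition joint_df Y r s x y : R :=
  fine (process_prob Y [set w | Y r w <= x /\ Y s w <= y]).

(* Generalized inverse of the marginal distribution function; the infimum is
   over a nonempty set bounded from below when 0 < tau < 1. *)
Definition quantile Y t tau : R := inf [set x | tau <= marginal_df Y t x].

Definition indicator_cov Y r a s b : R :=
  fine (covariance (process_prob Y) (\1_[set w | Y r w <= a])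
                                    (\1_[set w | Y s w <= b])).

(* For a strictly stationary Y, where the time origin is irrelevant. *)
Definition copula_acov Y h tau1 tau2 : R :=
  indicator_cov Y 0 (quantile Y 0 tau1) (- h) (quantile Y 0 tau2).

Definition expi x : R[i] := (cos x +i* sin x)%C.

Definition copula_spectral_density Y omega tau1 tau2 : R[i] :=
  ((2 * pi)^-1)%:C%C *
  Zseries (fun h =>
    (copula_acov Y h tau1 tau2)%:C%C * expi (- (h%:~R * omega))).

End Process.

Section TriangularArray.
Context {R : realType}.
(* X T t is the variable X_{t,T}; T ranges over T >= 1. *)
Implicit Types (X : nat -> process R) (Y : R -> process R).

Definition sup_dist (F G : R -> R -> R) : \bar R :=
  ereal_sup (range (fun z : R * R => `|F z.1 z.2 - G z.1 z.2|%:E)).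

Definition approximating_family X Y : Prop :=
  exists L : R, [/\ 0 < L,
    forall u : R, 0 < u < 1 -> strictly_stationary (Y u) &
    forall (T : nat) (u : R) (r s : int), (0 < T)%N -> 0 < u < 1 ->
      1 <= r <= T%:Z -> 1 <= s <= T%:Z ->
      (sup_dist (joint_df (X T) r s) (joint_df (Y u) 0%R (- (r - s))%R) <=
       (L * (Num.max `|r%:~R / T%:R - u| `|s%:~R / T%:R - u|
             + T%:R^-1))%:E)%E].

Definition locally_strictly_stationary X : Prop :=
  exists Y, approximating_family X Y.

Definition local_acov X (T : nat) (t0 s : int) (tau1 tau2 : R) : R :=
  let r1 := Num.floor (t0%:~R + s%:~R / 2 : R) in
  let r2 := Num.floor (t0%:~R - s%:~R / 2 : R) in
  indicator_cov (X T) r1 (quantile (X T) r1 tau1) r2 (quantile (X T) r2 tau2).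

Definition bounded_acov_sums X : Prop :=
  exists K : R, forall (t0 : int) (T : nat) (tau1 tau2 : R),
    (0 < T)%N -> 0 < tau1 < 1 -> 0 < tau2 < 1 ->
    (\esum_(s in [set: int]) `|local_acov X T t0 s tau1 tau2|%:E <= K%:E)%E.

Definition continuous_marginals X : Prop :=
  forall (t : int) (T : nat), (0 < T)%N -> continuous (marginal_df (X T) t).

End TriangularArray.

(* Main.v *)
(* With t0 = floor (u T), local strict stationarity makes the joint distribution
   function of the two variables in gamma_{t0;T}(h) uniformly close to that of
   (X_u(0), X_u(-h)), and likewise for their marginals.  A joint distribution
   function is Lipschitz in its marginals, and continuity of F_{t;T} forces
   G^u(q^u(tau)) to be close to tau, so no convergence of quantiles is needed:
   gamma_{t0;T}(h) converges to gamma^u_h as T tends to infinity.  Hence gamma^u_h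
   is a limit that depends on the array only, and its absolute sums inherit the
   bound K of condition (A). *)
Require Import Defs.
From HB Require Import structures.
From mathcomp Require Import all_boot all_order all_algebra.
From mathcomp Require Import all_classical all_reals all_analysis.
From mathcomp Require Import complex.
From mathcomp Require Import ring lra.
Import Order.TTheory GRing.Theory Num.Theory numFieldNormedType.Exports.
Local Open Scope classical_set_scope.
Local Open Scope ring_scope.

(** * Distribution functions, quantiles and indicator covariances of a single process *)

Section Process.
Context {R : realType}.
Implicit Types (Y Z : process R) (r s : int) (x y a b tau e : R).

Lemma measurable_le_event Y r x : measurable [set w | Y r w <= x].
Proof.
have -> : [set w | Y r w <= x] = Y r @^-1` `]-oo, x].
  by apply/seteqP; split=> w /=; rewrite in_itv.
by rewrite -[_ @^-1` _]setTI; exact: measurable_funP.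
Qed.

Lemma marginal_dfE Y r x :
  marginal_df Y r x = fine (process_prob Y [set w | Y r w <= x]).
Proof. by []. Qed.

Lemma joint_df_diag Y r x : joint_df Y r r x x = marginal_df Y r x.
Proof.
rewrite marginal_dfE; congr (fine (process_prob Y _)).
by apply/seteqP; split=> w /=; [case|].
Qed.

Lemma marginal_df_nondecreasing Y r : {homo marginal_df Y r : x y / x <= y}.
Proof.
by move=> x y xy; rewrite /marginal_df fine_le ?fin_num_measure// cdf_nondecreasing.
Qed.

Lemma marginal_df_ge0 Y r x : 0 <= marginal_df Y r x.
Proof. exact: fine_ge0. Qed.

Lemma marginal_df_le1 Y r x : marginal_df Y r x <= 1.
Proof. by rewrite -[leRHS]/(fine 1%E) fine_le ?fin_num_measure// cdf_le1. Qed.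

Lemma stationary_marginal_df Y r x : strictly_stationary Y ->
  marginal_df Y r x = marginal_df Y 0 x.
Proof.
move=> /(_ 1%N [tuple 0] r [set t | tnth t ord0 <= x]) stY.
rewrite !marginal_dfE; congr fine.
have mA : measurable [set t : 1.-tuple R | tnth t ord0 <= x].
  have -> : [set t : 1.-tuple R | tnth t ord0 <= x] =
            (fun t => tnth t ord0) @^-1` `]-oo, x].
    by apply/seteqP; split=> t /=; rewrite in_itv.
  by rewrite -[_ @^-1` _]setTI; exact: measurable_tnth.
move: (stY mA); rewrite /pushforward.
rewrite (_ : _ @^-1` _ = [set w | Y r w <= x]); last first.
  by apply/seteqP; split=> w /=; rewrite tnth_mktuple (tnth_nth 0)/= add0r.
rewrite (_ : _ @^-1` _ = [set w | Y 0 w <= x])//.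
by apply/seteqP; split=> w /=; rewrite tnth_mktuple (tnth_nth 0)/=.
Qed.

(** Reduces covariances to distribution functions, the only quantities that local stationarity
    controls. *)
Lemma indicator_covE Y r a s b :
  indicator_cov Y r a s b =
  joint_df Y r s a b - marginal_df Y r a * marginal_df Y s b.
Proof.
rewrite /indicator_cov /joint_df !marginal_dfE.
set A := [set w | Y r w <= a]; set B := [set w | Y s w <= b].
have mA : measurable A by exact: measurable_le_event.
have mB : measurable B by exact: measurable_le_event.
have mAB : measurable (A `&` B) by exact: measurableI.
have L1 C : measurable C -> \1_C \in Lfun (process_prob Y) 1.
  by move=> mC; apply/Lfun1_integrable; exact: integrable_indic.
have AB : (\1_A * \1_B)%R = \1_(A `&` B) :> (_ -> R) by rewrite indicI.
rewrite covarianceE ?AB ?L1// !expectation_indic//.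
by rewrite fineB ?fin_num_measure ?fin_numM ?fin_num_measure// fineM ?fin_num_measure.
Qed.

Lemma joint_dfC Y r s x y : joint_df Y r s x y = joint_df Y s r y x.
Proof.
congr (fine (process_prob Y _)).
by apply/seteqP; split=> w /= [].
Qed.

(** For [x <= x'], raising the threshold adds to the joint event only points of [A' \ A], whose
    probability is the increment of the marginal. *)
Lemma joint_df_lipschitz1 Y r s x x' y :
  `|joint_df Y r s x y - joint_df Y r s x' y| <=
  `|marginal_df Y r x - marginal_df Y r x'|.
Proof.
wlog xx' : x x' / x <= x'.
  by move=> H; case/orP: (le_total x x') => [/H//|/H]; rewrite distrC [leRHS]distrC.
rewrite !marginal_dfE /joint_df.
set P := process_prob Y; set A := [set w | Y r w <= x].
set A' := [set w | Y r w <= x']; set B := [set w | Y s w <= y].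
rewrite -/(A `&` B) -/(A' `&` B).
have [mA mA' mB] : [/\ measurable A, measurable A' & measurable B].
  by split; exact: measurable_le_event.
have AA' : A `<=` A' by move=> w /= /le_trans; apply.
have mI C : measurable C -> measurable (C `&` B) by move=> ?; exact: measurableI.
have mD : measurable (A' `\` A) by exact: measurableD.
have le1 : (P (A `&` B) <= P (A' `&` B))%E.
  by rewrite le_measure ?inE//; [exact: mI|exact: mI|exact: setSI].
have le2 : (P (A' `&` B) <= P (A `&` B) + (P A' - P A))%E.
  have -> : (P A' - P A = P (A' `\` A))%E.
    by rewrite measureD ?ltey_eq ?fin_num_measure// (setIidr AA').
  apply: (@le_trans _ _ (P ((A `&` B) `|` (A' `\` A)))); last first.
    by apply: measureU2 => //; exact: mI.
  rewrite le_measure ?inE//; [exact: mI|by apply: measurableU => //; exact: mI|].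
  by move=> w [A'w Bw]; have [Aw|nAw] := pselect (A w); [left|right].
have {}le1 := fine_le (fin_num_measure P _ (mI _ mA)) (fin_num_measure P _ (mI _ mA')) le1.
move: le2 => /fine_le; rewrite fin_numD fin_numB !fin_num_measure//; try exact: mI.
move=> /(_ erefl erefl); rewrite fineD ?fin_numB ?fin_num_measure//; last exact: mI.
rewrite fineB ?fin_num_measure// => le2.
by rewrite distrC [leRHS]distrC ger0_norm ?subr_ge0// ler_normr; apply/orP; left; lra.
Qed.

Lemma joint_df_lipschitz Y r s x y x' y' :
  `|joint_df Y r s x y - joint_df Y r s x' y'| <=
  `|marginal_df Y r x - marginal_df Y r x'| +
  `|marginal_df Y s y - marginal_df Y s y'|.
Proof.
apply: (le_trans (ler_distD (joint_df Y r s x' y) _ _)).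
by rewrite lerD ?joint_df_lipschitz1// !(joint_dfC Y r s x') joint_df_lipschitz1.
Qed.

(** The limits 1 and 0 of the distribution function at the two infinities give a member and a lower
    bound, so the infimum in [quantile] is a genuine one. *)
Lemma has_inf_quantile Y r tau : 0 < tau < 1 ->
  has_inf [set x | tau <= marginal_df Y r x].
Proof.
move=> /andP[tau0 tau1]; split.
  have /fine_cvg := @cvg_cdfy1 _ _ _ _ (Y r).
  move=> /cvgr_ge /(_ _ tau1) [M [_ HM]].
  by exists (M + 1); apply: HM; rewrite ltrDl.
have /fine_cvg := @cvg_cdfNy0 _ _ _ _ (Y r).
move=> /cvgr_lt /(_ _ tau0) [M [_ HM]].
exists M => x /= taux; rewrite leNgt; apply/negP => /HM.
by rewrite ltNge => /negP; apply.
Qed.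

(** Every point right of the quantile lies above a member of the set; right continuity carries the
    inequality to the quantile itself. *)
Lemma le_marginal_df_quantile Y r tau : 0 < tau < 1 ->
  tau <= marginal_df Y r (quantile Y r tau).
Proof.
move=> htau; have hi := @has_inf_quantile Y r _ htau.
have cv : marginal_df Y r x @[x --> (quantile Y r tau)^'+] -->
          marginal_df Y r (quantile Y r tau).
  apply: fine_cvg; rewrite fineK ?fin_num_measure//.
  exact: cdf_right_continuous.
apply: (cvgr_to_ge cv); near=> x.
have [z /= hz zx] : exists2 z, tau <= marginal_df Y r z & z < x.
  have qx : quantile Y r tau < x by near: x; exact: nbhs_right_gt.
  by case: (inf_lt hi.1 qx) => z; exists z.
exact: (le_trans hz (@marginal_df_nondecreasing Y r _ _ (ltW zx))).
Unshelve. all: by end_near. Qed.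

(* The marginal distribution function of [Y] need not be continuous: the continuous function [F]
   prevents it from jumping by more than [2 e] at the quantile. *)
Lemma marginal_df_quantile_dist Y r (F : R -> R) e tau :
  continuous F -> (forall x, `|F x - marginal_df Y r x| <= e) -> 0 < tau < 1 ->
  `|marginal_df Y r (quantile Y r tau) - tau| <= 2 * e.
Proof.
move=> cF FG htau; set q := quantile Y r tau.
have taule := @le_marginal_df_quantile Y r _ htau; rewrite -/q in taule.
rewrite ger0_norm ?subr_ge0// lerBlDr.
(* Left of [q] the marginal is below [tau], so [F] is below [tau + e]; continuity extends this to
   [q], and going back from [F] to the marginal costs a second [e]. *)
suff Fq : F q <= tau + e.
  by have := FG q; rewrite ler_distl => /andP[]; lra.
have cv : F x @[x --> q^'-] --> F q.
  by apply: cvg_at_left_filter; exact: cF.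
apply: (cvgr_to_le cv); near=> x.
have xq : x < q by near: x; exact: nbhs_left_lt.
have Gx : marginal_df Y r x < tau.
  rewrite ltNge; apply/negP => taux; move: xq; apply/negP; rewrite -leNgt.
  by apply: ge_inf => //; have [] := @has_inf_quantile Y r _ htau.
by have := FG x; rewrite ler_distl => /andP[]; lra.
Unshelve. all: by end_near. Qed.

Lemma marginal_df_quantile Y r tau :
  continuous (marginal_df Y r) -> 0 < tau < 1 ->
  marginal_df Y r (quantile Y r tau) = tau.
Proof.
move=> cY htau; apply/eqP; rewrite -subr_eq0 -normr_le0 -[leRHS](mulr0 2).
by apply: (@marginal_df_quantile_dist Y r (marginal_df Y r)) => // x; rewrite subrr normr0.
Qed.

(** The constant is 11 = 6 + 1 + 4: moving from the quantiles of [Y] to those of [Z] inside the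
    joint distribution function of [Y], replacing that function by the one of [Z], and comparing the
    products of marginals. *)
Lemma indicator_cov_quantile_dist Y Z r s e tau1 tau2 :
  strictly_stationary Z ->
  continuous (marginal_df Y r) -> continuous (marginal_df Y s) ->
  (forall x y, `|joint_df Y r s x y - joint_df Z 0 (- (r - s)) x y| <= e) ->
  (forall x, `|marginal_df Y r x - marginal_df Z 0 x| <= e) ->
  (forall x, `|marginal_df Y s x - marginal_df Z 0 x| <= e) ->
  0 < tau1 < 1 -> 0 < tau2 < 1 ->
  `|indicator_cov Y r (quantile Y r tau1) s (quantile Y s tau2)
     - copula_acov Z (r - s) tau1 tau2| <= 11 * e.
Proof.
move=> stZ cr cs hrs hr hs h1 h2.
rewrite /copula_acov !indicator_covE !(marginal_df_quantile Y)//.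
rewrite (stationary_marginal_df _ _ _ stZ).
have q1 := marginal_df_quantile_dist _ _ _ _ _ cr hr h1.
have q2 := marginal_df_quantile_dist _ _ _ _ _ cs hs h2.
set a := quantile Z 0 tau1 in q1 *; set b := quantile Z 0 tau2 in q2 *.
have lip := joint_df_lipschitz Y r s (quantile Y r tau1) (quantile Y s tau2) a b.
rewrite !(marginal_df_quantile Y)// in lip.
have := hrs a b; have := hr a; have := hs b.
move: q1 q2; rewrite !ler_distl => /andP[q1 q1'] /andP[q2 q2'] /andP[s1 s2].
move=> /andP[r1 r2] /andP[j1 j2].
have lip6 : `|joint_df Y r s (quantile Y r tau1) (quantile Y s tau2)
              - joint_df Y r s a b| <= 6 * e.
  (* Each [3 * e] is [2 * e] from [tau] to the marginal of [Z] at its quantile, plus [e] from there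
     to the marginal of [Y]. *)
  apply: (le_trans lip); rewrite (_ : 6 * e = 3 * e + 3 * e); last by ring.
  by apply: lerD; rewrite ler_distl; apply/andP; split; lra.
have prod4 : `|tau1 * tau2 - marginal_df Z 0 a * marginal_df Z 0 b| <= 4 * e.
  have -> : tau1 * tau2 - marginal_df Z 0 a * marginal_df Z 0 b =
      (tau1 - marginal_df Z 0 a) * tau2
      + marginal_df Z 0 a * (tau2 - marginal_df Z 0 b) by ring.
  rewrite (_ : 4 * e = 2 * e + 2 * e); last by ring.
  apply: (le_trans (ler_normD _ _)); rewrite !normrM; apply: lerD.
    rewrite -[leRHS]mulr1 ler_pM// ?ler_distl; last by rewrite ger0_norm; lra.
    by apply/andP; split; lra.
  rewrite -[leRHS]mul1r ler_pM//.
    by rewrite ger0_norm ?marginal_df_ge0// marginal_df_le1.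
  by rewrite ler_distl; apply/andP; split; lra.
move: lip6 prod4; rewrite !ler_distl => /andP[? ?] /andP[? ?].
by apply/andP; split; lra.
Qed.

End Process.

(** * Rounding of the time indices *)

Lemma floor_half_sub (R : realType) (t h : int) :
  Num.floor (t%:~R + h%:~R / 2 : R) - Num.floor (t%:~R - h%:~R / 2 : R) = h.
Proof.
have /andP[a1 a2] := floor_itv (t%:~R + h%:~R / 2 : R).
have /andP[b1 b2] := floor_itv (t%:~R - h%:~R / 2 : R).
set a := Num.floor _ in a1 a2 *; set b := Num.floor _ in b1 b2 *.
rewrite !intrD in a2 b2.
(* The unrounded arguments differ by [h] and each floor loses less than 1, so the integer [a - b]
   lies strictly between [h - 1] and [h + 1], whatever the parity of [h]. *)
apply/eqP; rewrite eq_le -!ltzD1 -!(ltr_int R) !intrD !mulrNz.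
by apply/andP; split; lra.
Qed.

Lemma dist_floor_floorD (R : realType) (x y : R) :
  `|(Num.floor ((Num.floor x)%:~R + y))%:~R - x| <= `|y| + 2.
Proof.
have /andP[a1 a2] := floor_itv x.
have /andP[b1 b2] := floor_itv ((Num.floor x)%:~R + y).
rewrite !intrD in a2 b2.
have := ler_norm y; have := ler_norm (- y); rewrite normrN => y1 y2.
by rewrite ler_distl; apply/andP; split; lra.
Qed.

(** * Convergence of the local autocovariances and summability of their limits *)

Section Convergence.
Context {R : realType}.
Variables (X : nat -> process R) (Y : R -> process R).
Hypotheses (hC : continuous_marginals X) (hY : approximating_family X Y).
Variables (u tau1 tau2 : R).
Hypotheses (hu : 0 < u < 1) (htau1 : 0 < tau1 < 1) (htau2 : 0 < tau2 < 1).

Lemma local_acov_cvg (h : int) :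
  local_acov X T (Num.floor (u * T%:R)) h tau1 tau2 @[T --> \oo] -->
  copula_acov (Y u) h tau1 tau2.
Proof.
have [L [L0 stY approx]] := hY; have /andP[u0 u1] := hu.
(* Bounds the distance of both time indices from [u * T], uniformly in [T]: the shift by half of
   [h], plus two roundings. *)
set c : R := `|h%:~R| + 2.
have c0 : 0 < c by rewrite ltr_wpDl.
apply/cvgrPdist_le => eps eps0; near=> T.
have T0 : (0 < T)%N by near: T; exact: nbhs_infty_gt.
have TR0 : 0 < T%:R :> R by rewrite ltr0n.
(* The three thresholds on [T] keep the indices at least 1, keep them at most [T], and bring the
   final error below [eps]. *)
have Tu : (c + 1) / u <= T%:R by near: T; exact: nbhs_infty_ger.
have Tu1 : c / (1 - u) <= T%:R by near: T; exact: nbhs_infty_ger.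
have Te : 11 * (L * (c + 1)) / eps <= T%:R by near: T; exact: nbhs_infty_ger.
rewrite ler_pdivrMr// in Te; rewrite ler_pdivrMr// in Tu; rewrite ler_pdivrMr ?subr_gt0// in Tu1.
have dist_idx (v : R) : `|v| <= `|h%:~R| ->
    let r := Num.floor ((Num.floor (u * T%:R))%:~R + v) in
    [/\ 1 <= r, r <= T%:Z & `|r%:~R / T%:R - u| <= c / T%:R].
  move=> hv r; have dr : `|r%:~R - u * T%:R| <= c.
    by apply: (le_trans (dist_floor_floorD _ _ _)); rewrite lerD2r.
  split.
  - rewrite -(ler_int R); move: dr; rewrite ler_distl => /andP[]; lra.
  - rewrite -(ler_int R); move: dr; rewrite ler_distl => /andP[]; lra.
  - rewrite -[X in _ - X](mulfK (lt0r_neq0 TR0)) -mulrBl normrM normfV.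
    by rewrite (gtr0_norm TR0) ler_pM2r ?invr_gt0.
have h2 : `|h%:~R / 2 : R| <= `|h%:~R|.
  by rewrite normrM normfV normr_nat ler_pdivrMr// ler_peMr// ler1n.
have [r1 rT rd] := dist_idx _ h2.
have h2N : `|- (h%:~R / 2) : R| <= `|h%:~R| by rewrite normrN.
have [s1 sT sd] := dist_idx _ h2N.
rewrite /local_acov.
set r := Num.floor _ in r1 rT rd *; set s := Num.floor (_ - _) in s1 sT sd *.
have joint_dist (p q : int) : 1 <= p <= T%:Z -> 1 <= q <= T%:Z ->
    `|p%:~R / T%:R - u| <= c / T%:R -> `|q%:~R / T%:R - u| <= c / T%:R ->
    forall x y, `|joint_df (X T) p q x y - joint_df (Y u) 0 (- (p - q)) x y|
                <= L * (c + 1) / T%:R.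
  move=> hp hq dp dq x y; rewrite -lee_fin.
  apply: (@le_trans _ _ (sup_dist (joint_df (X T) p q)
                                  (joint_df (Y u) 0 (- (p - q))))).
    by apply: ereal_sup_ubound; exists (x, y).
  apply: (le_trans (approx T u p q T0 hu hp hq)).
  rewrite lee_fin -mulrA mulrDl mul1r ler_pM2l// lerD2r.
  by rewrite ge_max dp dq.
(* The marginal bound is the joint one at equal indices, that is at lag 0, on the diagonal. *)
have marg_dist p : 1 <= p <= T%:Z -> `|p%:~R / T%:R - u| <= c / T%:R ->
    forall x, `|marginal_df (X T) p x - marginal_df (Y u) 0 x|
                <= L * (c + 1) / T%:R.
  move=> hp dp x; have := joint_dist p p hp hp dp dp x x.
  by rewrite subrr oppr0 !joint_df_diag.
have hr : 1 <= r <= T%:Z by rewrite r1.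
have hs : 1 <= s <= T%:Z by rewrite s1.
rewrite distrC.
have <- : r - s = h by exact: floor_half_sub.
apply: le_trans (indicator_cov_quantile_dist _ _ _ _ _ _ _ (stY u hu)
  (hC r T T0) (hC s T T0) (joint_dist r s hr hs rd sd)
  (marg_dist r hr rd) (marg_dist s hs sd) htau1 htau2) _.
by rewrite mulrA ler_pdivrMr// (mulrC eps).
Unshelve. all: by end_near. Qed.

(** Any finite sum of absolute values is a limit of finite sums of [local_acov], each at most [K];
    the supremum over finite sets keeps that bound. *)
Lemma summable_copula_acov : bounded_acov_sums X ->
  summable [set: int] (fun h => (copula_acov (Y u) h tau1 tau2)%:E).
Proof.
move=> [K hK]; rewrite /summable; apply: (@le_lt_trans _ _ K%:E); last exact: ltry.
apply: ge_ereal_sup => _ [A [finA _]] <-.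
rewrite fsbig_finite//= sumEFin lee_fin.
have cvgA : \sum_(h <- finmap.enum_fset (fset_set A))
      `|local_acov X T (Num.floor (u * T%:R)) h tau1 tau2| @[T --> \oo] -->
    \sum_(h <- finmap.enum_fset (fset_set A)) `|copula_acov (Y u) h tau1 tau2|.
  by apply: cvg_big => [|h _]; [exact: add_continuous|apply: cvg_norm; exact: local_acov_cvg].
apply: (cvgr_to_le cvgA); near=> T.
have T0 : (0 < T)%N by near: T; exact: nbhs_infty_gt.
rewrite -lee_fin; apply: le_trans (hK (Num.floor (u * T%:R)) T tau1 tau2 T0 htau1 htau2).
apply: ereal_sup_ubound; exists A => //.
by rewrite fsbig_finite//= sumEFin.
Unshelve. all: by end_near. Qed.

End Convergence.

Theorem corollary1 (R : realType) (X : nat -> process R)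
    (hlss : locally_strictly_stationary X)
    (hA : bounded_acov_sums X)
    (hC : continuous_marginals X)
    (Y Y' : R -> process R)
    (hY : approximating_family X Y) (hY' : approximating_family X Y')
    (u omega tau1 tau2 : R)
    (hu : 0 < u < 1) (homega : - pi < omega <= pi)
    (htau1 : 0 < tau1 < 1) (htau2 : 0 < tau2 < 1) :
  [/\ summable [set: int] (fun h => (copula_acov (Y u) h tau1 tau2)%:E),
      summable [set: int] (fun h => (copula_acov (Y' u) h tau1 tau2)%:E) &
      copula_spectral_density (Y u) omega tau1 tau2 =
      copula_spectral_density (Y' u) omega tau1 tau2].
Proof.
(* Both sides are limits of one sequence built from [X] alone, so the two series agree term by
   term. *)
have acovE h : copula_acov (Y u) h tau1 tau2 = copula_acov (Y' u) h tau1 tau2.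
  by apply: cvg_unique (local_acov_cvg _ _ hC hY _ _ _ hu htau1 htau2 h)
    (local_acov_cvg _ _ hC hY' _ _ _ hu htau1 htau2 h).
split; [exact: summable_copula_acov hC hY _ _ _ hu htau1 htau2 hA|
        exact: summable_copula_acov hC hY' _ _ _ hu htau1 htau2 hA|].
rewrite /copula_spectral_density; congr (_ * Zseries _).
by apply/funext => h; rewrite acovE.
Qed.
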